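(* Assume the stationary generator setting described in the context, and let $k\ge1$. Then $$H(R_0\mid Y_{1:k},R_k)-H(R_k\mid Y_{1:k},R_0)+\zeta_R(k)=I\big(\overleftarrow Y;R_0\,\big|\,\overrightarrow Y,R_k\big).$$ Consequently, for any random variable $X_{\rm dflt}$ on a finite alphabet with $X_{\rm dflt}^{\otimes k}$ ($k$ i.i.d. copies) independent of $R_0$, $$H\big(R_0,X_{\rm dflt}^{\otimes k}\big)-H\big(R_k,Y_{1:k}\big)=k\big[H(X_{\rm dflt})-h_Y\big]+I\big(\overleftarrow Y;R_0\,\big|\,\overrightarrow Y,R_k\big)\;\ge\;k\big[H(X_{\rm dflt})-h_Y\big].$$
   Context: Stationary generator setting: $\mathcal Y$ and $\mathcal R$ are finite sets. $(Y_t,R_t)_{t\in\mathbb Z}$ is a jointly stationary (shift-invariant) bi-infinite stochastic process with $Y_t\in\mathcal Y$ (the pattern) and $R_t\in\mathcal R$ (the memory state of the device after $Y_t$ has been produced). Generator condition: for every $t$, the collection $\big((Y_s)_{s\le t},(R_s)_{s<t}\big)$ is conditionally independent of $\big((Y_s)_{s>t},(R_s)_{s>t}\big)$ given $R_t$. Notation: $Y_{a:b}=(Y_a,\dots,Y_b)$; the past is $\overleftarrow{Y}=(\dots,Y_{-1},Y_0)$ and the future is $\overrightarrow{Y}=(Y_1,Y_2,\dots)$. Information quantities involving $\overleftarrow Y$ or $\overrightarrow Y$ are defined as limits $L\to\infty$ of the corresponding quantities with $Y_{-L+1:0}$ resp. $Y_{1:L}$. $H$ denotes Shannon entropy, $I(A;B\mid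 C)=H(A\mid C)-H(A\mid B,C)$ is conditional mutual information. The entropy rate is $h_Y=H(Y_1\mid\overleftarrow Y)$. The oracular information is $\zeta_R(k):=I(Y_{1:k};R_0\mid\overleftarrow Y)$. The quantity $I(\overleftarrow Y;R_0\mid\overrightarrow Y,R_k)$ is called the discarded cryptic information. *)

(* Defs.v *)
From Stdlib Require Import Reals.
From mathcomp Require Import all_boot.

Set Implicit Arguments.
Unset Strict Implicit.
Unset Printing Implicit Defensive.

Local Open Scope R_scope.

Definition xlnx (x : R) : R := if Rlt_dec 0 x then x * ln x else 0.

(** * The stationary joint process (Y_t, R_t)_{t in Z}.
    A stationary bi-infinite process with values in the finite alphabet
    Ya * Ra is given by its cylinder probabilities:
    [mu s] = P((Y_{t+1},R_{t+1}),...,(Y_{t+n},R_{t+n}) = s), which by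
    stationarity does not depend on t.  Kolmogorov consistency in both
    directions characterizes such processes. *)
Definition is_stat_process (Ya Ra : finType) (mu : seq (Ya * Ra) -> R) : Prop :=
  mu [::] = 1 /\
  (forall s, 0 <= mu s) /\
  (forall s, \big[Rplus/0]_(a : Ya * Ra) mu (rcons s a) = mu s) /\
  (forall s, \big[Rplus/0]_(a : Ya * Ra) mu (a :: s) = mu s).

(** Generator condition (on all finite windows): the past
    ((Y_s)_{s<=t},(R_s)_{s<t}) is conditionally independent of the future
    ((Y_s,R_s)_{s>t}) given R_t, i.e.
    P(U, Y_t=y, R_t=r, V) * P(R_t=r) = P(U, Y_t=y, R_t=r) * P(R_t=r, V)
    for every past block U = (Y_s,R_s)_{t-a<=s<t} and future block
    V = (Y_s,R_s)_{t<s<=t+b}. *)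
Definition is_generator (Ya Ra : finType) (mu : seq (Ya * Ra) -> R) : Prop :=
  forall (u v : seq (Ya * Ra)) (y : Ya) (r : Ra),
    mu (u ++ (y, r) :: v) * (\big[Rplus/0]_(y' : Ya) mu [:: (y', r)])
    = mu (rcons u (y, r)) * (\big[Rplus/0]_(y' : Ya) mu ((y', r) :: v)).

(** Shannon entropy (natural log) of a random variable [f w] that is a
    function of a window [w] of [n] consecutive symbols of the process. *)
Definition ent (Ya Ra : finType) (mu : seq (Ya * Ra) -> R) (n : nat)
    (T : eqType) (f : seq (Ya * Ra) -> T) : R :=
  - \big[Rplus/0]_(t <- undup [seq f (val w) | w : n.-tuple (Ya * Ra)])
      xlnx (\big[Rplus/0]_(w : n.-tuple (Ya * Ra) | f (val w) == t) mu (val w)).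

Definition cent (Ya Ra : finType) (mu : seq (Ya * Ra) -> R) (n : nat)
    (T1 T2 : eqType) (f : seq (Ya * Ra) -> T1) (g : seq (Ya * Ra) -> T2) : R :=
  ent mu n (fun w => (f w, g w)) - ent mu n g.

Definition cmi (Ya Ra : finType) (mu : seq (Ya * Ra) -> R) (n : nat)
    (T1 T2 T3 : eqType) (f : seq (Ya * Ra) -> T1) (g : seq (Ya * Ra) -> T2)
    (h : seq (Ya * Ra) -> T3) : R :=
  cent mu n f h - cent mu n f (fun w => (g w, h w)).

(** Selectors on a window w (position 0 = earliest time of the window). *)
Definition Yblk (Ya Ra : finType) (i len : nat) (w : seq (Ya * Ra)) : seq Ya :=
  [seq x.1 | x <- take len (drop i w)].
Definition Rpos (Ya Ra : finType) (i : nat) (w : seq (Ya * Ra)) : seq Ra :=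
  [seq x.2 | x <- take 1 (drop i w)].

Definition HR0_given (Ya Ra : finType) (mu : seq (Ya * Ra) -> R) (k : nat) : R :=
  cent mu k.+1 (@Rpos Ya Ra 0) (fun w => (Yblk 1 k w, Rpos k w)).

Definition HRk_given (Ya Ra : finType) (mu : seq (Ya * Ra) -> R) (k : nat) : R :=
  cent mu k.+1 (@Rpos Ya Ra k) (fun w => (Yblk 1 k w, Rpos 0 w)).

Definition H_Rk_Y1k (Ya Ra : finType) (mu : seq (Ya * Ra) -> R) (k : nat) : R :=
  ent mu k.+1 (fun w => (@Rpos Ya Ra k w, Yblk 1 k w)).

(** zeta_R(k) = lim_L I(Y_{1:k}; R_0 | Y_{-L:0}); the L-th term uses the
    window of times -L..k (length L+1+k), where time 0 is position L. *)
Definition zetaR_seq (Ya Ra : finType) (mu : seq (Ya * Ra) -> R) (k L : nat) : R :=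
  cmi mu (L.+1 + k) (@Yblk Ya Ra L.+1 k) (Rpos L) (Yblk 0 L.+1).

(** Discarded cryptic information
    I(past ; R_0 | future, R_k) = lim_L I(Y_{-L:0}; R_0 | Y_{1:L+1}, R_k);
    the L-th term uses the window of times -L..max(L+1,k). *)
Definition disc_seq (Ya Ra : finType) (mu : seq (Ya * Ra) -> R) (k L : nat) : R :=
  cmi mu (L.+1 + maxn L.+1 k) (@Yblk Ya Ra 0 L.+1) (Rpos L)
      (fun w => (Yblk L.+1 L.+1 w, Rpos (L + k) w)).

(** Entropy rate h_Y = lim_L H(Y_1 | Y_{-L:0}); window of times -L..1. *)
Definition hY_seq (Ya Ra : finType) (mu : seq (Ya * Ra) -> R) (L : nat) : R :=
  cent mu L.+2 (@Yblk Ya Ra L.+1 1) (Yblk 0 L.+1).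

Definition entp (T : finType) (p : T -> R) : R :=
  - \big[Rplus/0]_(t : T) xlnx (p t).

Definition pR0 (Ya Ra : finType) (mu : seq (Ya * Ra) -> R) (r : Ra) : R :=
  \big[Rplus/0]_(y : Ya) mu [:: (y, r)].

(* Main.v *)
(** Write b_n = H(Y_{-n:0}) and a_n = H(Y_{-n:0}, R_0).  The generator
    condition and stationarity give, for every finite L,
      I(Y_{1:k}; R_0 | Y_{-L:0})
        = b_{L+k} - b_L - H(Y_{1:k}, R_0) + H(R_0),
      I(Y_{-L:0}; R_0 | Y_{1:L+1}, R_k)
        = a_{L+k} - a_L - H(Y_{1:k}, R_k) + H(R_0)   (k <= L+1),
    the second because the part of the future beyond time k is screened off by
    R_k.  By submodularity b_{n+1} - b_n decreases to h_Y and
    a_n - b_n = H(R_0 | Y_{-n:0}) is nonincreasing and nonnegative, hence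
    convergent; so b_{L+k} - b_L and a_{L+k} - a_L both tend to k h_Y, which
    yields the identity. *)

From HB Require Import structures.
Require Import Defs.
From Stdlib Require Import Reals Lra.
From mathcomp Require Import all_boot.

Set Implicit Arguments.
Unset Strict Implicit.
Unset Printing Implicit Defensive.

Local Open Scope R_scope.

(** * Finite sums of reals and the convention for the logarithm at zero *)

HB.instance Definition _ := Monoid.isComLaw.Build R 0 Rplus
  (fun x y z => esym (Rplus_assoc x y z)) Rplus_comm Rplus_0_l.
HB.instance Definition _ := Monoid.isComLaw.Build R 1 Rmult
  (fun x y z => esym (Rmult_assoc x y z)) Rmult_comm Rmult_1_l.
HB.instance Definition _ := Monoid.isMulLaw.Build R 0 Rmult Rmult_0_l Rmult_0_r.
HB.instance Definition _ := Monoid.isAddLaw.Build R Rmult Rplus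
  Rmult_plus_distr_r Rmult_plus_distr_l.

Notation "\rsum_ ( i : t ) F" := (\big[Rplus/0]_(i : t) F)
  (at level 41, F at level 41, i at level 50,
   format "'[' \rsum_ ( i  :  t ) '/  '  F ']'") : R_scope.
Notation "\rsum_ ( i : t | P ) F" := (\big[Rplus/0]_(i : t | P) F)
  (at level 41, F at level 41, i at level 50,
   format "'[' \rsum_ ( i  :  t  |  P ) '/  '  F ']'") : R_scope.
Notation "\rsum_ ( i <- r ) F" := (\big[Rplus/0]_(i <- r) F)
  (at level 41, F at level 41, i, r at level 50,
   format "'[' \rsum_ ( i  <-  r ) '/  '  F ']'") : R_scope.

Lemma rsum_ge0 (I : Type) (r : seq I) (P : pred I) (F : I -> R) :
  (forall i, P i -> 0 <= F i) -> 0 <= \big[Rplus/0]_(i <- r | P i) F i.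
Proof. by move=> F0; apply: big_ind => //; [lra | move=> x y; lra]. Qed.

Lemma rsum_le (I : Type) (r : seq I) (P : pred I) (F G : I -> R) :
  (forall i, P i -> F i <= G i) ->
  \big[Rplus/0]_(i <- r | P i) F i <= \big[Rplus/0]_(i <- r | P i) G i.
Proof.
by move=> FG; apply: (big_ind2 Rle) => //; [lra | move=> x y z t; lra].
Qed.

Lemma rsum_opp (I : Type) (r : seq I) (P : pred I) (F : I -> R) :
  \big[Rplus/0]_(i <- r | P i) (- F i) = - \big[Rplus/0]_(i <- r | P i) F i.
Proof. by rewrite (big_morph Ropp Ropp_plus_distr Ropp_0). Qed.

Lemma xlnxE x : xlnx x = x * ln x.
Proof.
rewrite /xlnx; case: Rlt_dec => // nx.
by rewrite /ln; destruct (Rlt_dec 0 x) => //; rewrite Rmult_0_r.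
Qed.

Lemma ln_le_mono x y : 0 < x -> x <= y -> ln x <= ln y.
Proof.
move=> x0 [xy|->]; last lra.
by left; apply: ln_increasing.
Qed.

(** * Entropy on a finite probability space *)

Section FiniteEntropy.
Variables (W : finType) (p : W -> R).
Hypothesis p_ge0 : forall w, 0 <= p w.

(* The probability of the event [f = f w]. *)
Definition fiber (T : eqType) (f : W -> T) (w : W) : R :=
  \rsum_(v : W | f v == f w) p v.

(* Summing over outcomes [w] rather than over values of [f] makes the entropy
   depend only on the partition induced by [f]. *)
Definition entropy (T : eqType) (f : W -> T) : R :=
  - \rsum_(w : W) p w * ln (fiber f w).

(** Bridge from the sum over values to the sum over outcomes: after exchanging the double sum over
    [t] and [w], an outcome [w] meets only the value [t = f w]. *)
Lemma entropy_undup (T : eqType) (f : W -> T) :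
  - (\rsum_(t <- undup [seq f w | w : W])
       xlnx (\rsum_(w : W | f w == t) p w)) = entropy f.
Proof.
congr (- _).
pose c t := ln (\rsum_(w : W | f w == t) p w).
transitivity (\rsum_(t <- undup [seq f w | w : W])
   \rsum_(w : W) (if f w == t then p w * c t else 0)).
  apply: eq_bigr => t _; rewrite xlnxE -/(c t) big_distrl /=.
  by rewrite -big_mkcond.
rewrite exchange_big /=; apply: eq_bigr => w _.
rewrite (bigD1_seq (f w)) ?undup_uniq //=; last first.
  by rewrite mem_undup; apply: image_f.
rewrite eqxx big1 ?Rplus_0_r // => t.
by rewrite eq_sym => /negPf ->.
Qed.

Lemma fiber_ge (T : eqType) (f : W -> T) w : p w <= fiber f w.
Proof.
rewrite /fiber (bigD1 w) //=.
set S := \big[_/_]_(_ | _) _; suff: 0 <= S by lra.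
exact: rsum_ge0.
Qed.

Lemma fiber_gt0 (T : eqType) (f : W -> T) w : 0 < p w -> 0 < fiber f w.
Proof. have := fiber_ge f w; lra. Qed.

Lemma eq_fiber (T T' : eqType) (f : W -> T) (g : W -> T') :
  (forall v w, (f v == f w) = (g v == g w)) -> fiber f =1 fiber g.
Proof. by move=> fg w; apply: eq_bigl => v. Qed.

Lemma fiber_transfer (T : eqType) (f : W -> T) v w :
  f v = f w -> fiber f v = fiber f w.
Proof. by move=> fvw; apply: eq_bigl => u; rewrite fvw. Qed.

Lemma eq_entropy (T T' : eqType) (f : W -> T) (g : W -> T') :
  (forall v w, (f v == f w) = (g v == g w)) -> entropy f = entropy g.
Proof.
by move=> fg; congr (- _); apply: eq_bigr => w _; rewrite (eq_fiber fg).
Qed.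

(** Each fiber of the pair lies inside the fiber of [g], and [ln] is monotone. *)
Lemma entropy_pair_ge (T1 T2 : eqType) (f : W -> T1) (g : W -> T2) :
  entropy g <= entropy (fun w => (f w, g w)).
Proof.
apply: Ropp_le_contravar; apply: rsum_le => w _.
case: (p_ge0 w) => [pw|<-]; last lra.
apply: Rmult_le_compat_l; first lra.
apply: ln_le_mono; first exact: fiber_gt0.
rewrite /fiber [X in _ <= X](bigID (fun v => f v == f w)) /=.
set S := \big[_/_]_(_ | _) _; set S1 := \big[_/_]_(_ | _) _.
set S2 := \big[_/_]_(_ | _) _.
have -> : S = S1 by apply: eq_bigl => v; rewrite xpair_eqE andbC.
suff: 0 <= S2 by lra.
exact: rsum_ge0.
Qed.

Section TripleEntropy.
Variables (T1 T2 T3 : eqType) (f : W -> T1) (g : W -> T2) (h : W -> T3).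

Let fgh := fun w => (f w, (g w, h w)).
Let fh := fun w => (f w, h w).
Let gh := fun w => (g w, h w).

(** The logarithm of the factorization is taken outcome by outcome; outcomes of mass 0 contribute
    nothing, and on the others all fibers are positive. *)
Lemma entropy_cond_indep :
  (forall w, fiber fgh w * fiber h w = fiber fh w * fiber gh w) ->
  entropy fgh + entropy h = entropy fh + entropy gh.
Proof.
move=> indep; rewrite /entropy -!Ropp_plus_distr -!big_split /=.
congr (- _); apply: eq_bigr => w _.
case: (p_ge0 w) => [pw|<-]; last lra.
rewrite -!Rmult_plus_distr_l -!ln_mult ?indep //; exact: fiber_gt0.
Qed.

(** This is the mass bound behind Gibbs' inequality. Opening the two numerator fibers gives a triple
    sum in which [w] agrees with [u] on [f, h] and with [v] on [g, h]. Summing over [w] first leaves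
    a factor at most 1, and then summing over [v] cancels [fiber h u]. *)
Lemma fiber_ratio_sum :
  \rsum_(w : W) (p w / fiber fgh w * (fiber fh w * fiber gh w / fiber h w))
  <= \rsum_(w : W) p w.
Proof.
pose c u v w := [&& f u == f w, h u == h w, g v == g w & h v == h w].
have -> : \rsum_(w : W)
    (p w / fiber fgh w * (fiber fh w * fiber gh w / fiber h w)) =
    \rsum_(u : W) \rsum_(v : W) (p u * p v / fiber h u *
      (\rsum_(w : W | c u v w) (p w / fiber fgh w))).
  under [RHS]eq_bigr => u _ do under eq_bigr => v _ do
    rewrite big_distrr /= big_mkcond /=.
  under [RHS]eq_bigr => u _ do rewrite exchange_big /=.
  rewrite [RHS]exchange_big /=; apply: eq_bigr => w _.
  rewrite {2 3}/fiber (big_mkcond (fun v => fh v == _)).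
  rewrite (big_mkcond (fun v => gh v == _)) /Rdiv !big_distrl big_distrr /=.
  apply: eq_bigr => u _; rewrite big_distrr big_distrl big_distrr /=.
  apply: eq_bigr => v _; rewrite /c !xpair_eqE.
  case: (f u == f w); rewrite /= ?Rmult_0_l ?Rmult_0_r //.
  case: eqP => [huw|_]; rewrite /= ?Rmult_0_l ?Rmult_0_r //.
  case: (_ && _); rewrite ?Rmult_0_l ?Rmult_0_r ?Rmult_0_l ?Rmult_0_r //.
  rewrite (fiber_transfer huw); ring.
apply: rsum_le => u _.
apply: (@Rle_trans _ (\rsum_(v : W) (if h v == h u then p u * p v / fiber h u else 0))).
  apply: rsum_le => v _; case: eqP => [hvu|hvu]; last first.
    rewrite big_pred0 ?Rmult_0_r; first exact: Rle_refl.
    by move=> w; apply/negP => /and4P[_ /eqP huw _ /eqP hvw]; rewrite huw hvw in hvu.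
  rewrite -[X in _ <= X]Rmult_1_r.
  case: (p_ge0 u) => [pu|<-]; last by rewrite /Rdiv !Rmult_0_l; exact: Rle_refl.
  apply: Rmult_le_compat_l.
    apply: Rmult_le_pos; first by apply: Rmult_le_pos => //; lra.
    by apply: Rlt_le; apply: Rinv_0_lt_compat; exact: fiber_gt0.
  (* Since [h v = h u], the compatible [w] form the whole [fgh]-fiber of any one of them. Every
     denominator is thus [S], and the sum is 1, or 0 when [S = 0]. *)
  set S := \rsum_(w : W | c u v w) p w.
  have -> : \rsum_(w : W | c u v w) (p w / fiber fgh w) = S * / S.
    rewrite big_distrl; apply: eq_bigr => w /and4P[/eqP fuw /eqP huw /eqP gvw _].
    congr (_ * / _); apply: eq_bigl => x; rewrite /c hvu fuw huw gvw !xpair_eqE.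
    rewrite (eq_sym (f x)) (eq_sym (g x)) (eq_sym (h x)); case: (f w == f x); case: (h w == h x) => //=.
    by rewrite andbF.
  have [<-|S0] := Req_dec 0 S; first by rewrite Rmult_0_l; lra.
  by rewrite Rinv_r; [lra | move=> /esym].
rewrite -big_mkcond /Rdiv /= -big_distrl -big_distrr /= -/(fiber h u).
case: (p_ge0 u) => [pu|<-]; last by rewrite !Rmult_0_l; exact: Rle_refl.
have := fiber_gt0 h pu => hu; apply: Req_le; field; lra.
Qed.

(* Gibbs: [ln x <= x - 1] at [x = P(f,h) P(g,h) / (P(f,g,h) P(h))]. *)
Lemma entropy_submod :
  entropy fgh + entropy h <= entropy fh + entropy gh.
Proof.
rewrite /entropy -!Ropp_plus_distr -!big_split /=.
apply: Ropp_le_contravar.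
set A := (X in X <= _); set B := (X in _ <= X).
suff: A - B <= 0 by lra.
apply: (@Rle_trans _ (\rsum_(w : W)
  (p w / fiber fgh w * (fiber fh w * fiber gh w / fiber h w))
  - \rsum_(w : W) p w)); last by have := fiber_ratio_sum; lra.
rewrite /Rminus -!rsum_opp -!big_split /=.
apply: rsum_le => w _.
case: (p_ge0 w) => [pw|<-]; last by rewrite /Rdiv; lra.
have P1 := fiber_gt0 fgh pw; have P2 := fiber_gt0 fh pw.
have P3 := fiber_gt0 gh pw; have P4 := fiber_gt0 h pw.
set x := (fiber fh w * fiber gh w) / (fiber fgh w * fiber h w).
have x0 : 0 < x.
  by apply: Rdiv_lt_0_compat; apply: Rmult_lt_0_compat.
have lnx : ln x <= x - 1 by have := exp_ineq1_le (ln x); rewrite exp_ln //; lra.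
have lnxE : ln x = ln (fiber fh w) + ln (fiber gh w)
                  - (ln (fiber fgh w) + ln (fiber h w)).
  rewrite /x /Rdiv ln_mult ?ln_Rinv ?ln_mult //; try exact: Rmult_lt_0_compat.
  by apply: Rinv_0_lt_compat; exact: Rmult_lt_0_compat.
have -> : p w / fiber fgh w * (fiber fh w * fiber gh w / fiber h w)
   = p w * x by rewrite /x; field; lra.
have := Rmult_le_compat_l _ _ _ (Rlt_le _ _ pw) lnx.
rewrite lnxE; lra.
Qed.

End TripleEntropy.
End FiniteEntropy.

(** * Windows of the stationary process *)

Lemma rsum_tuple0 (A : finType) (F : seq A -> R) :
  \rsum_(w : 0.-tuple A) F w = F [::].
Proof.
rewrite (bigD1 [tuple]) //= big1 ?Rplus_0_r // => w /eqP[].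
by apply: val_inj; exact: size0nil (size_tuple w).
Qed.

Lemma rsum_tupleS (A : finType) n (F : seq A -> R) :
  \rsum_(w : n.+1.-tuple A) F w = \rsum_(a : A) \rsum_(w : n.-tuple A) F (a :: w).
Proof.
rewrite pair_big /=.
rewrite (reindex (fun x : A * n.-tuple A => [tuple of x.1 :: x.2])) //=.
exists (fun w => (thead w, [tuple of behead w])) => [[a w] _|w _] /=.
  by congr pair; apply: val_inj.
by rewrite -tuple_eta.
Qed.

Lemma rsum_tuple_cat (A : finType) m n (F : seq A -> R) :
  \rsum_(w : (m + n).-tuple A) F w =
  \rsum_(u : m.-tuple A) \rsum_(v : n.-tuple A) F (u ++ v).
Proof.
elim: m F => [|m IH] F.
  by rewrite (@rsum_tuple0 _ (fun u => \rsum_(v : n.-tuple A) F (u ++ v))).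
rewrite (@rsum_tupleS _ _ (fun u => \rsum_(v : n.-tuple A) F (u ++ v))).
rewrite (@rsum_tupleS _ (m + n)); apply: eq_bigr => a _.
exact: (IH (fun w => F (a :: w))).
Qed.

Section Windows.
Variables (Ya Ra : finType) (mu : seq (Ya * Ra) -> R).
Hypothesis mu_stat : is_stat_process mu.
Local Notation A := (Ya * Ra)%type.

Let mu_ge0 s : 0 <= mu s.
Proof. by case: mu_stat => _ []. Qed.

Lemma rsum_suffix n s : \rsum_(v : n.-tuple A) mu (s ++ v) = mu s.
Proof.
elim: n s => [|n IH] s.
  by rewrite (rsum_tuple0 (fun v => mu (s ++ v))) cats0.
rewrite (rsum_tupleS _ (fun v => mu (s ++ v))).
case: mu_stat => _ [_ [<- _]]; apply: eq_bigr => a _.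
by rewrite -IH; apply: eq_bigr => v _; rewrite cat_rcons.
Qed.

Lemma rsum_prefix n s : \rsum_(u : n.-tuple A) mu (u ++ s) = mu s.
Proof.
elim: n => [|n IH].
  by rewrite (rsum_tuple0 (fun u => mu (u ++ s))).
rewrite (rsum_tupleS _ (fun u => mu (u ++ s))) exchange_big -IH /=.
by apply: eq_bigr => u _; case: mu_stat => _ [_ [_ ->]].
Qed.

(** The [m] symbols before and the [N - (m + n)] symbols after the window are summed out by the two
    Kolmogorov consistency conditions. *)
Lemma rsum_window m n N (G : seq A -> R) : (m + n <= N)%N ->
  \rsum_(w : N.-tuple A) mu w * G (take n (drop m w)) =
  \rsum_(w : n.-tuple A) mu w * G w.
Proof.
move=> /subnKC <-; rewrite -addnA; set l := (N - _)%N.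
rewrite (rsum_tuple_cat _ _ (fun w => mu w * G (take n (drop m w)))).
under eq_bigr => u _ do
  rewrite (rsum_tuple_cat n l (fun v => mu (u ++ v) * G (take n (drop m (u ++ v))))).
rewrite exchange_big /=; apply: eq_bigr => w _.
have mid (u : m.-tuple A) (v : seq A) : take n (drop m (u ++ w ++ v)) = w.
  by rewrite drop_size_cat ?size_tuple // take_size_cat ?size_tuple.
under eq_bigr => u _ do under eq_bigr => v _ do rewrite mid catA.
under eq_bigr => u _ do rewrite -big_distrl rsum_suffix /=.
by rewrite -big_distrl rsum_prefix.
Qed.

Lemma ent_entropy n (T : eqType) (f : seq A -> T) :
  ent mu n f = entropy (fun w : n.-tuple A => mu w) (fun w => f w).
Proof. by rewrite -entropy_undup. Qed.

Lemma eq_ent n (T T' : eqType) (f : seq A -> T) (g : seq A -> T') :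
  (forall w w', size w = n -> size w' = n -> (f w == f w') = (g w == g w')) ->
  ent mu n f = ent mu n g.
Proof.
by move=> fg; rewrite !ent_entropy; apply: eq_entropy => v w; apply: fg;
  rewrite size_tuple.
Qed.

(** Stationarity for entropies: neither the position of the window nor the length of the ambient one
    matters. *)
Lemma ent_window m n N (T : eqType) (g : seq A -> T) : (m + n <= N)%N ->
  ent mu N (fun w => g (take n (drop m w))) = ent mu n g.
Proof.
move=> mnN; rewrite !ent_entropy; congr (- _).
rewrite -(@rsum_window m n N
  (fun s => ln (\rsum_(v : n.-tuple A | g v == g s) mu v)) mnN).
apply: eq_bigr => w _; congr (_ * ln _).
rewrite /fiber big_mkcond [RHS]big_mkcond /=.
(* The fiber probability is the expectation of the indicator [G], so [rsum_window] applies to it as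
   well. *)
pose G s := if g s == g (take n (drop m w)) then 1 else 0.
transitivity (\rsum_(v : N.-tuple A) mu v * G (take n (drop m v))).
  by apply: eq_bigr => v _; rewrite /G; case: ifP => _; ring.
rewrite rsum_window //; apply: eq_bigr => v _.
by rewrite /G; case: ifP => _; ring.
Qed.

Lemma ent_pair_ge n (T1 T2 : eqType) (f : seq A -> T1) (g : seq A -> T2) :
  ent mu n g <= ent mu n (fun w => (f w, g w)).
Proof. rewrite !ent_entropy; exact: entropy_pair_ge. Qed.

Lemma ent_submod n (T1 T2 T3 : eqType)
    (f : seq A -> T1) (g : seq A -> T2) (h : seq A -> T3) :
  ent mu n (fun w => (f w, (g w, h w))) + ent mu n h <=
  ent mu n (fun w => (f w, h w)) + ent mu n (fun w => (g w, h w)).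
Proof. rewrite !ent_entropy; exact: entropy_submod. Qed.

(** * From the generator condition to conditional independence of entropies *)

Hypothesis mu_gen : is_generator mu.

Section CondIndep.
Variables (a b N : nat).
Hypothesis NE : N = (a + b.+1)%N.

Let ind (P : bool) : R := if P then 1 else 0.

(* Probability that the symbols before position [a] and [Y_a] satisfy [P],
   [R_a = r], and the [b] symbols after position [a] satisfy [Q]. *)
Let split_sum (P : seq A -> Ya -> bool) (Q : seq A -> bool) (r : Ra) : R :=
  \rsum_(u : a.-tuple A) \rsum_(y : Ya) \rsum_(v : b.-tuple A)
    ind (P u y) * ind (Q v) * mu (u ++ (y, r) :: v).

Lemma split_sumE (E : pred (seq A)) P Q r :
  (forall u y r' v, size u = a ->
     E (u ++ (y, r') :: v) = [&& P u y, Q v & r' == r]) ->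
  \rsum_(w : N.-tuple A | E w) mu w = split_sum P Q r.
Proof.
move=> EPQ; rewrite NE big_mkcond.
rewrite (rsum_tuple_cat _ _ (fun w => if E w then mu w else 0)).
apply: eq_bigr => u _.
rewrite (rsum_tupleS _ (fun v => if E (u ++ v) then mu (u ++ v) else 0)).
pose F y r := \rsum_(v : b.-tuple A)
  (if E (u ++ (y, r) :: v) then mu (u ++ (y, r) :: v) else 0).
transitivity (\rsum_(z : A) F z.1 z.2); first by apply: eq_bigr => -[].
rewrite -(pair_bigA _ F) /=.
apply: eq_bigr => y _; rewrite exchange_big; apply: eq_bigr => v _.
rewrite (bigD1 r) //= big1 ?Rplus_0_r => [|r' /negPf nr]; last first.
  by rewrite EPQ ?size_tuple // nr !andbF.
rewrite EPQ ?size_tuple // eqxx andbT /ind.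
by case: (P u y); case: (Q v) => /=; ring.
Qed.

(** The generator identity is summed over [u, y] with weight [P] and over [v] with weight [Q];
    whichever side is unconstrained sums out by consistency. *)
Lemma split_sum_indep P Q r :
  split_sum P Q r * split_sum (fun _ _ => true) (fun _ => true) r =
  split_sum P (fun _ => true) r * split_sum (fun _ _ => true) Q r.
Proof.
have -> : split_sum (fun _ _ => true) (fun _ => true) r = \rsum_(y : Ya) mu [:: (y, r)].
  rewrite /split_sum exchange_big; apply: eq_bigr => y _.
  rewrite -[RHS](rsum_prefix a); apply: eq_bigr => u _.
  rewrite -[RHS](rsum_suffix b); apply: eq_bigr => v _.
  by rewrite -catA /= !Rmult_1_l.
have -> : split_sum (fun _ _ => true) Q r =
    \rsum_(v : b.-tuple A) ind (Q v) * \rsum_(y : Ya) mu ((y, r) :: v).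
  rewrite /split_sum exchange_big /=.
  under [RHS]eq_bigr => v _ do rewrite big_distrr /=.
  rewrite [RHS]exchange_big /=; apply: eq_bigr => y _; rewrite exchange_big.
  apply: eq_bigr => v _; rewrite -big_distrr /= rsum_prefix /=; ring.
have -> : split_sum P (fun _ => true) r =
    \rsum_(u : a.-tuple A) \rsum_(y : Ya) ind (P u y) * mu (rcons u (y, r)).
  apply: eq_bigr => u _; apply: eq_bigr => y _.
  rewrite -big_distrr /= -(rsum_suffix b (rcons u (y, r))).
  under eq_bigr => v _ do rewrite -cat_rcons.
  by rewrite /=; ring.
rewrite /split_sum !big_distrl; apply: eq_bigr => u _.
rewrite !big_distrl; apply: eq_bigr => y _.
rewrite big_distrl big_distrr; apply: eq_bigr => v _ /=.
by rewrite Rmult_assoc mu_gen; ring.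
Qed.

(** The memory state at position [a] screens off [f] from [g]: [f] may read everything up to [Y_a]
    except [R_a] itself, [g] only what comes strictly later. *)
Lemma ent_generator (T1 T2 : eqType) (f : seq A -> T1) (g : seq A -> T2)
    (f1 : seq A -> Ya -> T1) (g1 : seq A -> T2) :
  (forall u y r v, size u = a -> f (u ++ (y, r) :: v) = f1 u y) ->
  (forall u y r v, size u = a -> g (u ++ (y, r) :: v) = g1 v) ->
  ent mu N (fun w => (f w, (g w, Rpos a w))) + ent mu N (Rpos a) =
  ent mu N (fun w => (f w, Rpos a w)) + ent mu N (fun w => (g w, Rpos a w)).
Proof.
move=> ff1 gg1; rewrite !ent_entropy.
apply: (@entropy_cond_indep _ _ _ _ _ _ (fun w : N.-tuple A => f w)
  (fun w : N.-tuple A => g w) (fun w : N.-tuple A => Rpos a w)) => // w.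
have [u0 [y0 [r0 [v0 [su0 wE]]]]] :
    exists u y r v, size u = a /\ val w = u ++ (y, r) :: v.
  have sw : (a < size w)%N by rewrite size_tuple NE -addSnnS leq_addr.
  exists (take a w); case: (drop a w) (cat_take_drop a w) (size_drop a w) => [|[y r] v] wE.
    by move=> /esym/eqP; rewrite subn_eq0 leqNgt sw.
  by move=> _; exists y, r, v; rewrite size_takel ?wE // ltnW.
have RposE u y r v : size u = a -> Rpos a (u ++ (y, r) :: v) = [:: r].
  by move=> <-; rewrite /Rpos drop_size_cat //= take0.
pose P u y := f1 u y == f1 u0 y0; pose Q v := g1 v == g1 v0.
rewrite /fiber /= wE ff1 // gg1 // RposE //.
have sub (R : eqType) (r r' : R) : ([:: r'] == [:: r]) = (r' == r).
  by rewrite eqseq_cons andbT.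
rewrite (@split_sumE (fun s => (f s, (g s, Rpos a s)) == (f1 u0 y0, (g1 v0, [:: r0]))) P Q r0);
  last by move=> u y r v su; rewrite !xpair_eqE ff1 // gg1 // RposE // sub.
rewrite (@split_sumE (fun s => (f s, Rpos a s) == (f1 u0 y0, [:: r0])) P (fun _ => true) r0);
  last by move=> u y r v su; rewrite !xpair_eqE ff1 // RposE // sub.
rewrite (@split_sumE (fun s => (g s, Rpos a s) == (g1 v0, [:: r0])) (fun _ _ => true) Q r0);
  last by move=> u y r v su; rewrite !xpair_eqE gg1 // RposE // sub.
rewrite (@split_sumE (fun s => Rpos a s == [:: r0]) (fun _ _ => true) (fun _ => true) r0);
  last by move=> u y r v su; rewrite RposE // sub.
exact: split_sum_indep.
Qed.
End CondIndep.

(** * Block entropies *)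

Lemma Yblk_cat i l1 l2 (w : seq A) :
  Yblk i (l1 + l2) w = Yblk i l1 w ++ Yblk (i + l1) l2 w.
Proof. by rewrite /Yblk takeD map_cat drop_drop addnC. Qed.

Lemma eq_Yblk_cat i l1 l2 (w w' : seq A) : size w = size w' ->
  (Yblk i (l1 + l2) w == Yblk i (l1 + l2) w') =
  (Yblk i l1 w == Yblk i l1 w') && (Yblk (i + l1) l2 w == Yblk (i + l1) l2 w').
Proof.
move=> sw; rewrite !Yblk_cat eqseq_cat //.
by rewrite /Yblk !size_map !size_take !size_drop sw.
Qed.

Lemma Yblk_sub i l m n (w : seq A) : (i + l <= n)%N ->
  Yblk i l (take n (drop m w)) = Yblk (m + i) l w.
Proof.
move=> iln; congr map.
by rewrite take_drop take_takel 1?addnC // addnC -take_drop drop_drop addnC.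
Qed.

Lemma Rpos_sub i m n (w : seq A) : (i < n)%N ->
  Rpos i (take n (drop m w)) = Rpos (m + i) w.
Proof.
move=> ltin; congr map.
by rewrite take_drop take_takel ?add1n // -[i.+1]add1n -take_drop drop_drop addnC.
Qed.

Lemma ent_sub m n N (T T' : eqType) (f : seq A -> T) (g : seq A -> T') :
  (m + n <= N)%N ->
  (forall w w', size w = N -> size w' = N ->
     (f w == f w') = (g (take n (drop m w)) == g (take n (drop m w')))) ->
  ent mu N f = ent mu n g.
Proof. by move=> mnN fg; rewrite -(ent_window g mnN); exact: eq_ent. Qed.

(** [entY] and [entYR] are the sequences b_n and a_n; index [n] stands for [n.+1] symbols, the last
    one at time 0. *)
Definition entY (n : nat) : R := ent mu n.+1 (@Yblk Ya Ra 0 n.+1).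
Definition entYR (n : nat) : R :=
  ent mu n.+1 (fun w => (@Yblk Ya Ra 0 n.+1 w, Rpos n w)).
Definition entR : R := ent mu 1 (@Rpos Ya Ra 0).
Definition entYR0 (k : nat) : R :=
  ent mu k.+1 (fun w => (@Yblk Ya Ra 1 k w, Rpos 0 w)).
Definition entYRk (k : nat) : R :=
  ent mu k.+1 (fun w => (@Yblk Ya Ra 1 k w, Rpos k w)).

Lemma entY_sub m n N : (m + n < N)%N -> ent mu N (@Yblk Ya Ra m n.+1) = entY n.
Proof.
move=> mnN; apply: (@ent_sub m); first by rewrite addnS.
by move=> w w' _ _; rewrite !Yblk_sub // addn0.
Qed.

Lemma entR_sub m N : (m < N)%N -> ent mu N (@Rpos Ya Ra m) = entR.
Proof.
move=> mN; apply: (@ent_sub m); first by rewrite addn1.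
by move=> w w' _ _; rewrite !Rpos_sub // addn0.
Qed.

Lemma entYR_sub m n N : (m + n < N)%N ->
  ent mu N (fun w => (@Yblk Ya Ra m n.+1 w, Rpos (m + n) w)) = entYR n.
Proof.
move=> mnN; apply: (@ent_sub m); first by rewrite addnS.
by move=> w w' _ _; rewrite !Yblk_sub // !Rpos_sub // addn0.
Qed.

Lemma entYR0_sub m k N : (m + k < N)%N ->
  ent mu N (fun w => (@Yblk Ya Ra m.+1 k w, Rpos m w)) = entYR0 k.
Proof.
move=> mnN; apply: (@ent_sub m); first by rewrite addnS.
by move=> w w' _ _; rewrite !Yblk_sub // !Rpos_sub // addn0 addn1.
Qed.

Lemma entYRk_sub m k N : (m + k < N)%N ->
  ent mu N (fun w => (@Yblk Ya Ra m.+1 k w, Rpos (m + k) w)) = entYRk k.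
Proof.
move=> mnN; apply: (@ent_sub m); first by rewrite addnS.
by move=> w w' _ _; rewrite !Yblk_sub // !Rpos_sub // addn1.
Qed.

(** * Closed forms of the oracular and discarded information on finite windows *)

Lemma Yblk_past i l a u y r (v : seq A) : size u = a -> (i + l = a.+1)%N ->
  Yblk i l (u ++ (y, r) :: v) = drop i (rcons [seq x.1 | x <- u] y).
Proof.
move=> su il; rewrite /Yblk map_take map_drop map_cat -cat_rcons take_drop.
by rewrite addnC il take_size_cat // size_rcons size_map su.
Qed.

Lemma Yblk_future i l a u y r (v : seq A) : size u = a ->
  Yblk (a.+1 + i) l (u ++ (y, r) :: v) = Yblk i l v.
Proof.
move=> su; rewrite /Yblk -cat_rcons addnC -drop_drop drop_size_cat //.
by rewrite size_rcons su.
Qed.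

Lemma Rpos_future i a u y r (v : seq A) : size u = a ->
  Rpos (a.+1 + i) (u ++ (y, r) :: v) = Rpos i v.
Proof.
move=> su; rewrite /Rpos -cat_rcons addnC -drop_drop drop_size_cat //.
by rewrite size_rcons su.
Qed.

(** Time 0 is position [L]. Screening by R_0 evaluates the joint entropy of past, R_0 and Y_{1:k},
    and [entYR L] then cancels. *)
Lemma zetaR_seqE k L :
  zetaR_seq mu k L = entY (L + k) - entY L - entYR0 k + entR.
Proof.
rewrite /zetaR_seq /cmi /cent.
have -> : ent mu (L.+1 + k) (fun w => (@Yblk Ya Ra L.+1 k w, Yblk 0 L.+1 w))
    = entY (L + k).
  apply: eq_ent => w w' sw sw'; rewrite -addSn eq_Yblk_cat ?sw //.
  by rewrite xpair_eqE andbC.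
rewrite entY_sub ?add0n ?addSn ?ltnS ?leq_addr //.
have -> : ent mu (L + k).+1 (fun w => (@Rpos Ya Ra L w, Yblk 0 L.+1 w)) = entYR L.
  rewrite -(@entYR_sub 0 L (L + k).+1) ?add0n ?ltnS ?leq_addr //.
  by apply: eq_ent => w w' _ _; rewrite !xpair_eqE andbC.
have NE : ((L + k).+1 = L + k.+1)%N by rewrite addnS.
have past u y r (v : seq A) : size u = L ->
    Yblk 0 L.+1 (u ++ (y, r) :: v) = drop 0 (rcons [seq x.1 | x <- u] y).
  by move=> su; exact: (Yblk_past (a := L)).
have future u y r (v : seq A) : size u = L ->
    Yblk L.+1 k (u ++ (y, r) :: v) = Yblk 0 k v.
  by move=> su; rewrite -[L.+1]addn0 (Yblk_future _ _ _ _ _ su).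
have gen := ent_generator NE past future.
rewrite (@entYR_sub 0) ?entR_sub ?entYR0_sub ?ltnS ?leq_addr // in gen.
have -> : ent mu (L + k).+1
    (fun w => (@Yblk Ya Ra L.+1 k w, (Rpos L w, Yblk 0 L.+1 w)))
    = entYR L + entYR0 k - entR.
  rewrite -gen Rplus_minus_r; apply: eq_ent => w w' _ _.
  by rewrite !xpair_eqE andbA andbC.
ring.
Qed.

(** The window is cut twice, at R_0 and at R_k. The entropies [G] and [F], which carry the rest of
    the future, each occur twice with opposite signs and cancel. *)
Lemma disc_seqE k L : (0 < k)%N -> (k <= L.+1)%N ->
  disc_seq mu k L = entYR (L + k) - entYR L - entYRk k + entR.
Proof.
move=> k0 kL; rewrite /disc_seq /cmi /cent (maxn_idPl kL).
set N := (L.+1 + L.+1)%N.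
set l := (L.+1 - k)%N; have lE : (k + l = L.+1)%N by rewrite subnKC.
have NE0 : N = (L + L.+2)%N by rewrite /N addSnnS.
have NEk : N = (L + k + l.+1)%N by rewrite NE0 -addnA [(k + _)%N]addnS lE.
have ltLkN : (L + k < N)%N by rewrite NEk addnS ltnS leq_addr.
have ltLN : (L < N)%N by apply: leq_ltn_trans ltLkN; exact: leq_addr.
have past0 u y r (v : seq A) : size u = L ->
    Yblk 0 L.+1 (u ++ (y, r) :: v) = drop 0 (rcons [seq x.1 | x <- u] y).
  by move=> su; exact: (Yblk_past (a := L)).
(* The part [v] starts at time 1, so R_k is its entry [k.-1]; positivity of [k] puts R_k strictly
   after R_0. *)
have future0 u y r (v : seq A) : size u = L ->
    (Yblk L.+1 L.+1 (u ++ (y, r) :: v), Rpos (L + k) (u ++ (y, r) :: v))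
    = (Yblk 0 L.+1 v, Rpos k.-1 v).
  move=> su; rewrite -{1}[L.+1]addn0 (Yblk_future _ _ _ _ _ su).
  by rewrite -(prednK k0) addnS -addSn (Rpos_future _ _ _ _ su).
have gen0 := ent_generator
  (g := fun w => (Yblk L.+1 L.+1 w, Rpos (L + k) w)) NE0 past0 future0.
rewrite (@entYR_sub 0) // entR_sub // in gen0.
have pastk u y r (v : seq A) : size u = (L + k)%N ->
    Yblk 0 (L + k).+1 (u ++ (y, r) :: v) = drop 0 (rcons [seq x.1 | x <- u] y).
  by move=> su; exact: (Yblk_past (a := L + k)).
have pastk' u y r (v : seq A) : size u = (L + k)%N ->
    Yblk L.+1 k (u ++ (y, r) :: v) = drop L.+1 (rcons [seq x.1 | x <- u] y).
  by move=> su; exact: (Yblk_past (a := L + k)).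
have futurek u y r (v : seq A) : size u = (L + k)%N ->
    Yblk (L + k).+1 l (u ++ (y, r) :: v) = Yblk 0 l v.
  by move=> su; rewrite -[(L + k).+1]addn0 (Yblk_future _ _ _ _ _ su).
(* [R_k] screens off [Y_{k+1:L+1}] both from [Y_{-L:k}] and from [Y_{1:k}]. *)
have genk := ent_generator NEk pastk futurek.
have genk' := ent_generator NEk pastk' futurek.
rewrite (@entYR_sub 0) // entR_sub // in genk.
rewrite entYRk_sub // entR_sub // in genk'.
have splitF (w w' : seq A) : size w = N -> size w' = N ->
    (@Yblk Ya Ra L.+1 L.+1 w == Yblk L.+1 L.+1 w') =
    (Yblk L.+1 k w == Yblk L.+1 k w') &&
    (Yblk (L + k).+1 l w == Yblk (L + k).+1 l w').
  by move=> sw sw'; have := @eq_Yblk_cat L.+1 k l w w'; rewrite lE; apply; rewrite sw.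
have splitP (w w' : seq A) : size w = N -> size w' = N ->
    (@Yblk Ya Ra 0 (L + k).+1 w == Yblk 0 (L + k).+1 w') =
    (Yblk 0 L.+1 w == Yblk 0 L.+1 w') &&
    (Yblk L.+1 k w == Yblk L.+1 k w').
  by move=> sw sw'; rewrite -addSn eq_Yblk_cat ?sw.
set F := ent mu N (fun w => (Yblk (L + k).+1 l w, Rpos (L + k) w)) in genk genk'.
have -> : ent mu N (fun w => (@Yblk Ya Ra 0 L.+1 w, (Yblk L.+1 L.+1 w, Rpos (L + k) w)))
    = entYR (L + k) + F - entR.
  rewrite -genk Rplus_minus_r; apply: eq_ent => w w' sw sw'.
  by rewrite !xpair_eqE splitF // splitP // -!andbA.
have -> : ent mu N (fun w => (@Yblk Ya Ra L.+1 L.+1 w, Rpos (L + k) w))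
    = entYRk k + F - entR.
  rewrite -genk' Rplus_minus_r; apply: eq_ent => w w' sw sw'.
  by rewrite !xpair_eqE splitF // -!andbA.
set G := ent mu N (fun w => ((Yblk L.+1 L.+1 w, Rpos (L + k) w), Rpos L w)) in gen0.
have -> : ent mu N (fun w => (@Rpos Ya Ra L w, (Yblk L.+1 L.+1 w, Rpos (L + k) w))) = G.
  by apply: eq_ent => w w' _ _; rewrite !xpair_eqE andbC.
have -> : ent mu N (fun w => (@Yblk Ya Ra 0 L.+1 w,
      (Rpos L w, (Yblk L.+1 L.+1 w, Rpos (L + k) w)))) = entYR L + G - entR.
  rewrite -gen0 Rplus_minus_r; apply: eq_ent => w w' _ _.
  by rewrite !xpair_eqE; congr (_ && _); rewrite andbC.
ring.
Qed.

(** * Signs and monotonicity of the entropy sequences *)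

Lemma cmi_ge0 n (T1 T2 T3 : eqType)
    (f : seq A -> T1) (g : seq A -> T2) (h : seq A -> T3) : 0 <= cmi mu n f g h.
Proof.
have aux x y z t : x + y <= z + t -> 0 <= z - y - (x - t) by lra.
exact: aux (ent_submod n f g h).
Qed.

(** Both conditional entropies start from the same joint entropy of R_0, Y_{1:k} and R_k, which
    cancels. *)
Lemma HR0_sub_HRk k : HR0_given mu k - HRk_given mu k = entYR0 k - entYRk k.
Proof.
rewrite /HR0_given /HRk_given /cent -/(entYRk k) -/(entYR0 k).
have -> : ent mu k.+1 (fun w => (@Rpos Ya Ra 0 w, (Yblk 1 k w, Rpos k w))) =
   ent mu k.+1 (fun w => (@Rpos Ya Ra k w, (Yblk 1 k w, Rpos 0 w))).
  by apply: eq_ent => w w' _ _; rewrite !xpair_eqE andbC -andbA andbCA.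
have aux x y z : x - y - (x - z) = z - y by ring.
exact: aux.
Qed.

Lemma H_Rk_Y1kE k : H_Rk_Y1k mu k = entYRk k.
Proof. by apply: eq_ent => w w' _ _; rewrite !xpair_eqE andbC. Qed.

Lemma hY_seqE L : hY_seq mu L = entY L.+1 - entY L.
Proof.
rewrite /hY_seq /cent entY_sub //; congr (_ - _).
apply: eq_ent => w w' sw sw'.
by rewrite -[L.+2]addn1 eq_Yblk_cat ?sw // xpair_eqE andbC.
Qed.

Lemma hY_seq_ge0 L : 0 <= hY_seq mu L.
Proof.
rewrite /hY_seq /cent.
have := ent_pair_ge L.+2 (@Yblk Ya Ra L.+1 1) (@Yblk Ya Ra 0 L.+1); lra.
Qed.

(** Submodularity for the first and the last of [n.+3] symbols given the [n.+1] between them; by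
    stationarity all four terms are block entropies. *)
Lemma hY_seq_decr : Un_decreasing (hY_seq mu).
Proof.
move=> n; rewrite !hY_seqE.
have := ent_submod n.+3 (@Yblk Ya Ra 0 1) (@Yblk Ya Ra n.+2 1) (@Yblk Ya Ra 1 n.+1).
rewrite entY_sub //.
have -> : ent mu n.+3 (fun w => (@Yblk Ya Ra 0 1 w, (Yblk n.+2 1 w, Yblk 1 n.+1 w)))
    = entY n.+2.
  apply: eq_ent => w w' sw sw'; rewrite !xpair_eqE.
  rewrite [RHS](eq_Yblk_cat 0 1 n.+2) ?sw //; congr (_ && _).
  by have := @eq_Yblk_cat 1 n.+1 1 w w'; rewrite addn1 => ->; rewrite ?sw // andbC.
have -> : ent mu n.+3 (fun w => (@Yblk Ya Ra 0 1 w, Yblk 1 n.+1 w)) = entY n.+1.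
  rewrite -(@entY_sub 0 _ n.+3) //; apply: eq_ent => w w' sw sw'.
  by rewrite !xpair_eqE -[n.+2]add1n eq_Yblk_cat ?sw.
have -> : ent mu n.+3 (fun w => (@Yblk Ya Ra n.+2 1 w, Yblk 1 n.+1 w)) = entY n.+1.
  rewrite -(@entY_sub 1 _ n.+3) //; apply: eq_ent => w w' sw sw'.
  have := @eq_Yblk_cat 1 n.+1 1 w w'; rewrite addn1 => ->; last by rewrite sw.
  by rewrite !xpair_eqE andbC.
lra.
Qed.

Lemma entYR_sub_entY_ge0 n : 0 <= entYR n - entY n.
Proof.
have := ent_pair_ge n.+1 (@Rpos Ya Ra n) (@Yblk Ya Ra 0 n.+1).
rewrite -/(entY n).
have -> : ent mu n.+1 (fun w => (@Rpos Ya Ra n w, Yblk 0 n.+1 w)) = entYR n.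
  by apply: eq_ent => w w' _ _; rewrite !xpair_eqE andbC.
lra.
Qed.

(** Submodularity again: the earliest symbol and the final memory state, given the remaining
    symbols. *)
Lemma entYR_sub_entY_decr : Un_decreasing (fun n => entYR n - entY n).
Proof.
move=> n.
have := ent_submod n.+2 (@Yblk Ya Ra 0 1) (@Rpos Ya Ra n.+1) (@Yblk Ya Ra 1 n.+1).
rewrite entY_sub //.
have -> : ent mu n.+2 (fun w => (@Yblk Ya Ra 0 1 w, (Rpos n.+1 w, Yblk 1 n.+1 w)))
    = entYR n.+1.
  apply: eq_ent => w w' sw sw'; rewrite !xpair_eqE (eq_Yblk_cat 0 1 n.+1) ?sw //.
  by rewrite -andbA; congr (_ && _); rewrite andbC.
have -> : ent mu n.+2 (fun w => (@Yblk Ya Ra 0 1 w, Yblk 1 n.+1 w)) = entY n.+1.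
  apply: eq_ent => w w' sw sw'.
  by rewrite !xpair_eqE -[n.+2]add1n eq_Yblk_cat ?sw.
have -> : ent mu n.+2 (fun w => (@Rpos Ya Ra n.+1 w, Yblk 1 n.+1 w)) = entYR n.
  rewrite -(@entYR_sub 1 _ n.+2) //; apply: eq_ent => w w' sw sw'.
  by rewrite !xpair_eqE andbC.
lra.
Qed.


(** * I.i.d. copies and limits *)

(** Identifies the window entropy of R_0 with that of the marginal [pR0], by grouping the one-symbol
    windows by memory state. *)
Lemma entR_E : entR = - \rsum_(r : Ra) xlnx (pR0 mu r).
Proof.
rewrite /entR ent_entropy; congr (- _).
pose F s := mu s * ln (\rsum_(v : 1.-tuple A | Rpos 0 v == Rpos 0 s) mu v).
rewrite -[LHS]/(\rsum_(w : 1.-tuple A) F w) rsum_tupleS.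
under eq_bigr => z _ do rewrite (rsum_tuple0 (fun w => F (z :: w))).
have FE y r : F [:: (y, r)] = mu [:: (y, r)] * ln (pR0 mu r).
  congr (_ * ln _); rewrite big_mkcond.
  rewrite (rsum_tupleS _ (fun v => if Rpos 0 v == [:: r] then mu v else 0)).
  under eq_bigr => z _ do
    rewrite (rsum_tuple0 (fun v => if Rpos 0 (z :: v) == [:: r] then mu (z :: v) else 0)).
  transitivity (\rsum_(z : A) if z.2 == r then mu [:: (z.1, z.2)] else 0).
    by apply: eq_bigr => -[y' r'] _; rewrite /Rpos /= eqseq_cons andbT.
  rewrite -(pair_bigA _ (fun y r' => if r' == r then mu [:: (y, r')] else 0)).
  by apply: eq_bigr => y' _; rewrite -big_mkcond big_pred1_eq.
transitivity (\rsum_(z : A) F [:: (z.1, z.2)]); first by apply: eq_bigr => -[].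
rewrite -(pair_bigA _ (fun y r => F [:: (y, r)])) exchange_big.
apply: eq_bigr => r _; rewrite xlnxE big_distrl.
by apply: eq_bigr => y _; rewrite FE.
Qed.

Lemma pR0_ge0 r : 0 <= pR0 mu r.
Proof. exact: rsum_ge0. Qed.

Lemma pR0_sum1 : \rsum_(r : Ra) pR0 mu r = 1.
Proof.
rewrite exchange_big /=; case: mu_stat => <- [_ [/(_ [::]) <- _]].
by rewrite (pair_bigA _ (fun y r => mu [:: (y, r)])); apply: eq_bigr => -[].
Qed.

End Windows.

Lemma xlnxM x y : 0 <= x -> 0 <= y -> xlnx (x * y) = xlnx x * y + x * xlnx y.
Proof.
move=> [x0|<-]; last by rewrite !xlnxE !Rmult_0_l; lra.
move=> [y0|<-]; last by rewrite !xlnxE !Rmult_0_r; lra.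
by rewrite !xlnxE ln_mult //; ring.
Qed.

(** [xlnx] obeys a product rule, also at 0, and the normalizations of [p] and [q] remove the extra
    factors. *)
Lemma entp_indep (S T : finType) (p : S -> R) (q : T -> R) :
  (forall s, 0 <= p s) -> (forall t, 0 <= q t) ->
  \rsum_(s : S) p s = 1 -> \rsum_(t : T) q t = 1 ->
  \rsum_(s : S) \rsum_(t : T) xlnx (p s * q t)
  = \rsum_(s : S) xlnx (p s) + \rsum_(t : T) xlnx (q t).
Proof.
move=> p0 q0 p1 q1.
transitivity (\rsum_(s : S) (xlnx (p s) + p s * \rsum_(t : T) xlnx (q t))).
  apply: eq_bigr => s _; under eq_bigr => t _ do rewrite xlnxM //.
  by rewrite big_split -!big_distrr /= q1 Rmult_1_r.
by rewrite big_split -big_distrl /= p1 Rmult_1_l.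
Qed.

Section IidEntropy.
Variables (X : finType) (pX : X -> R).
Hypotheses (pX_ge0 : forall x, 0 <= pX x) (pX_sum1 : \rsum_(x : X) pX x = 1).

Definition iid (s : seq X) : R := \big[Rmult/1]_(x <- s) pX x.

Lemma iid_ge0 s : 0 <= iid s.
Proof.
by apply: big_ind => //; [lra | move=> x y; exact: Rmult_le_pos].
Qed.

Lemma iid_sum1 k : \rsum_(w : k.-tuple X) iid w = 1.
Proof.
elim: k => [|k IH]; first by rewrite rsum_tuple0 /iid big_nil.
rewrite rsum_tupleS -[RHS]pX_sum1; apply: eq_bigr => x _.
under eq_bigr => w _ do rewrite /iid big_cons.
by rewrite -big_distrr /= IH Rmult_1_r.
Qed.

Lemma entp_iid k :
  \rsum_(w : k.-tuple X) xlnx (iid w) = INR k * \rsum_(x : X) xlnx (pX x).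
Proof.
elim: k => [|k IH].
  by rewrite (rsum_tuple0 (fun w => xlnx (iid w))) /iid big_nil xlnxE ln_1 /=; ring.
rewrite (rsum_tupleS _ (fun w => xlnx (iid w))) S_INR.
under eq_bigr => x _ do under eq_bigr => w _ do rewrite /iid big_cons -/(iid w).
rewrite (@entp_indep X _ pX (fun w : k.-tuple X => iid w)) //.
- by rewrite IH; ring.
- by move=> w; exact: iid_ge0.
- exact: iid_sum1.
Qed.

End IidEntropy.

(** * Convergence of real sequences and passage to the limit *)

Lemma Un_cv_eventually (u v : nat -> R) (n0 : nat) l :
  (forall n, (n0 <= n)%N -> u n = v n) -> Un_cv u l -> Un_cv v l.
Proof.
move=> uv ul e e0; have [M HM] := ul e e0; exists (maxn M n0) => n.
move=> /leP; rewrite geq_max => /andP[Mn n0n].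
by rewrite -uv //; apply: HM; apply/leP.
Qed.

Lemma Un_cv_const c : Un_cv (fun=> c) c.
Proof. by move=> e e0; exists 0%N => n _; rewrite R_dist_eq. Qed.

Lemma Un_cv_decr (u : nat -> R) :
  (forall n, 0 <= u n) -> Un_decreasing u -> exists l, Un_cv u l.
Proof.
move=> u0 du.
have lb : has_lb u by exists 0 => x [n ->]; rewrite /opp_seq; have := u0 n; lra.
by have [l ul] := decreasing_cv _ du lb; exists l.
Qed.

Lemma Un_cv_ge0 (u : nat -> R) l : (forall n, 0 <= u n) -> Un_cv u l -> 0 <= l.
Proof. move=> u0; exact: (@Rle_cv_lim (fun=> 0) u 0 l u0 (Un_cv_const 0)). Qed.

(** The increment over [k] steps telescopes into [k] shifted one-step increments, each tending to
    [l]. *)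
Lemma Un_cv_increment (u : nat -> R) l k :
  Un_cv (fun n => u n.+1 - u n) l -> Un_cv (fun n => u (n + k)%N - u n) (INR k * l).
Proof.
move=> ul; elim: k => [|k IH].
  apply: (Un_cv_eventually (u := fun=> 0) (n0 := 0)) => [n _|].
    by rewrite addn0; ring.
  by rewrite Rmult_0_l; exact: Un_cv_const.
rewrite S_INR Rmult_plus_distr_r Rmult_1_l.
apply: (Un_cv_eventually (n0 := 0)) (CV_plus _ _ _ _ IH (CV_shift' _ k _ ul)).
by move=> n _; rewrite plusE addnS; ring.
Qed.

Theorem theorem1 (Ya Ra : finType) (mu : seq (Ya * Ra) -> R) (k : nat) :
  is_stat_process mu -> is_generator mu -> (1 <= k)%N ->
  (exists zeta D : R,
      Un_cv (zetaR_seq mu k) zeta /\ Un_cv (disc_seq mu k) D /\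
      HR0_given mu k - HRk_given mu k + zeta = D) /\
  (forall (X : finType) (pX : X -> R) (q : Ra * k.-tuple X -> R),
      (forall x, 0 <= pX x) -> \big[Rplus/0]_(x : X) pX x = 1 ->
      (forall r xs, q (r, xs) = pR0 mu r * \big[Rmult/1]_(i < k) pX (tnth xs i)) ->
      exists D hY : R,
        Un_cv (disc_seq mu k) D /\ Un_cv (hY_seq mu) hY /\
        entp q - H_Rk_Y1k mu k = INR k * (entp pX - hY) + D /\
        INR k * (entp pX - hY) <= entp q - H_Rk_Y1k mu k).
Proof.
move=> mu_stat mu_gen k0.
have [hY hYl] := Un_cv_decr (hY_seq_ge0 mu_stat) (hY_seq_decr mu_stat).
have [e el] := Un_cv_decr (entYR_sub_entY_ge0 mu_stat) (entYR_sub_entY_decr mu_stat).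
have dY : Un_cv (fun L => entY mu (L + k) - entY mu L) (INR k * hY).
  apply: Un_cv_increment; apply: (Un_cv_eventually (n0 := 0)) hYl => n _.
  exact: hY_seqE.
pose c := entR mu - entYRk mu k.
have zl : Un_cv (zetaR_seq mu k) (INR k * hY + (entR mu - entYR0 mu k)).
  apply: (Un_cv_eventually (n0 := 0)) (CV_plus _ _ _ _ dY (Un_cv_const _)).
  by move=> n _; rewrite zetaR_seqE //; ring.
have dl : Un_cv (disc_seq mu k) (INR k * hY + c).
  (* Writing a_L = b_L + e_L with e_L convergent, the difference of e_{L+k} and e_L tends to 0, so a
     has the same limiting increment as b. The closed form needs [k <= L.+1], hence the starting
     index [k]. *)
  have := CV_plus _ _ _ _ (CV_plus _ _ _ _ dY
    (CV_minus _ _ _ _ (CV_shift' _ k _ el) el)) (Un_cv_const c).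
  rewrite Rminus_diag Rplus_0_r; apply: (Un_cv_eventually (n0 := k)) => n kn.
  by rewrite disc_seqE ?(leq_trans kn) // plusE /c; ring.
(* The limit of conditional mutual informations is nonnegative, which gives the final inequality. *)
have D0 : 0 <= INR k * hY + c by apply: Un_cv_ge0 dl => L; exact: cmi_ge0.
split.
  exists (INR k * hY + (entR mu - entYR0 mu k)), (INR k * hY + c).
  by split=> //; split=> //; rewrite HR0_sub_HRk /c; ring.
move=> X pX q pX0 pX1 qE.
(* [q] is the product of the law of R_0 and [k] copies of [pX], so entropies add. *)
have qH : entp q = entR mu + INR k * entp pX.
  rewrite entR_E // /entp -Ropp_mult_distr_r -Ropp_plus_distr; congr (- _).
  rewrite -(entp_iid pX0 pX1) -entp_indep; last exact: iid_sum1.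
  - rewrite (pair_bigA _ (fun r (w : k.-tuple X) => xlnx (pR0 mu r * iid pX w))).
    by apply: eq_bigr => -[r w] _; rewrite qE /iid big_tuple.
  - exact: pR0_ge0.
  - by move=> w; exact: iid_ge0.
  - exact: pR0_sum1.
exists (INR k * hY + c), hY; do 2!split=> //.
have E : entp q - H_Rk_Y1k mu k = INR k * (entp pX - hY) + (INR k * hY + c).
  by rewrite qH H_Rk_Y1kE /c; ring.
by split=> //; rewrite E; lra.
Qed.
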